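(* Let $K$ be a field and $G$ a group. For each elementary partial representation $\pi:G\to M_n(KH)$ the map $$\phi_\pi:K^n\rtimes_{\alpha^\pi}G\to M_n(KH),\qquad \sum_{g\in G}a_g\delta_g\mapsto\sum_{g\in G}a_g\pi(g),$$ is an isomorphism.
   Context: **Partial actions.** Algebras are associative $K$-algebras. A partial action $\alpha$ of $G$ on an algebra $\mathcal{A}$ is a collection of two-sided ideals $\mathcal{D}_g$ of $\mathcal{A}$ and algebra isomorphisms $\alpha_g:\mathcal{D}_{g^{-1}}\to\mathcal{D}_g$ $(g\in G)$ such that $\mathcal{D}_1=\mathcal{A}$, $\alpha_1=\mathrm{id}$; $\mathcal{D}_{(gh)^{-1}}\supseteq\alpha_h^{-1}(\mathcal{D}_h\cap\mathcal{D}_{g^{-1}})$; and $\alpha_g\circ\alpha_h(x)=\alpha_{gh}(x)$ for $x\in\alpha_h^{-1}(\mathcal{D}_h\cap\mathcal{D}_{g^{-1}})$. The skew group ring $\mathcal{A}\rtimes_\alpha G$ is the set of finite formal sums $\sum_g a_g\delta_g$, $a_g\in\mathcal{D}_g$, with the obvious addition and multiplication determined by $(a_g\delta_g)(b_h\delta_h)=\alpha_g(\alpha_{g^{-1}}(a_g)b_h)\delta_{gh}$. **Partial representations.** A partial representation of $G$ into a unital $K$-algebra $\mathcal{B}$ is a map $\pi:G\to\mathcal{B}$ with $\pi(1)=1$ and, for all $g,h\in G$, $\pi(g)\pi(h)\pi(h^{-1})=\pi(gh)\pi(h^{-1})$ and $\pi(g^{-1})\pi(g)\pi(h)=\pi(g^{-1})\pi(gh)$.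 The elements $\varepsilon_g=\pi(g)\pi(g^{-1})$ are commuting idempotents. Let $\mathcal{A}$ be the subalgebra of $\mathcal{B}$ they generate and $\mathcal{D}_g=\varepsilon_g\mathcal{A}$. The maps $\alpha^\pi_g:\mathcal{D}_{g^{-1}}\to\mathcal{D}_g$, $\alpha_g^\pi(a)=\pi(g)a\pi(g^{-1})$, form a partial action $\alpha^\pi$ of $G$ on $\mathcal{A}$. **Elementary partial representations.** Let $A\subseteq G$ with $1\in A$, let $H=\mathrm{St}(A)=\{h\in G:hA=A\}$ (so $A$ is a union of right cosets $Hg$), and suppose $A$ is the union of a finite number $n=(A:H)$ of such cosets. Left multiplication of $A$ by elements $g$ with $g^{-1}\in A$ gives exactly $n$ distinct sets $A=A_1,A_2,\dots,A_n$, each containing $1$. Let $\Gamma$ be the groupoid with objects $A_1,\dots,A_n$, whose morphisms $A_i\to A_j$ are the pairs $(A_i,g)$ with $g\in G$, $gA_i=A_j$ (so $g^{-1}\in A_i$), with composition $(A_i,g)\circ(A_j,g')=(A_j,gg')$ defined iff $g'A_j=A_i$. Let $K\Gamma$ be the groupoid algebra ($K$-basis the morphisms; products of non-composable morphisms are $0$). For each $i$ fix $g_i\in G$ with $g_iA=A_i$; then $\tau:K\Gamma\to M_n(KH)$, $(A_i,g)\mapsto e_{j,i}(g_j^{-1}gg_i)$ where $gA_i=A_j$, is an algebra isomorphism; here $e_{j,i}(h)$ is the $n\times n$ matrix whose unique non-zero entry is $h\in H$ in position $(j,i)$. The map $\lambda:G\to K\Gamma$, $\lambda(g)=\sum_{A_i\ni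 g^{-1}}(A_i,g)$ (equal to $0$ if $g^{-1}\notin\bigcup_iA_i$), is a partial representation. The partial representations $\pi=\tau\circ\lambda:G\to M_n(KH)$ obtained in this way are called elementary. For elementary $\pi$, the algebra generated by the $\varepsilon_g$ is the diagonal subalgebra $\mathrm{diag}(K,\dots,K)\cong K^n$ of $M_n(K)\subseteq M_n(KH)$, so $\alpha^\pi$ is viewed as a partial action of $G$ on $K^n$. *)

(* Defs.v *)
From HB Require Import structures.
From mathcomp Require Import all_boot all_order all_algebra.
From mathcomp Require Import finmap monalg.
From mathcomp Require Import boolp classical_sets functions cardinality.

Set Implicit Arguments.
Unset Strict Implicit.
Unset Printing Implicit Defensive.

Import GRing.Theory.

Local Open Scope classical_set_scope.
Local Open Scope card_scope.
Local Open Scope ring_scope.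

(* [{malg K[H]}] only has a ring structure when [H] is a [monomType], which
   excludes nontrivial groups; hence the alias with its own product. *)
Definition group_algebra (K : fieldType) (H : groupType) : Type := {malg K[H]}.

Section GroupAlgebra.
Variables (K : fieldType) (H : groupType).
Local Notation KH := (group_algebra K H).

HB.instance Definition _ := GRing.Lmodule.copy KH {malg K[H]}.

Implicit Types (x y : H) (a b : K) (f g : KH).

Definition ga_one : KH := << 1%g >>.
Definition ga_mul f g : KH :=
  \sum_(x <- msupp f) \sum_(y <- msupp g) << f@_x * g@_y *g (x * y)%g >>.

Lemma ga_mulw (d1 d2 : {fset H}) f g :
  (msupp f `<=` d1)%fset -> (msupp g `<=` d2)%fset ->
  ga_mul f g = \sum_(x <- d1) \sum_(y <- d2) << f@_x * g@_y *g (x * y)%g >>.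
Proof.
move=> le1 le2; rewrite /ga_mul (big_fset_incl _ le1) /=.
  apply/eq_bigr=> x _; apply/big_fset_incl => // y _ /mcoeff_outdom ->.
  by rewrite mulr0 monalgU0.
move=> x _ /mcoeff_outdom f0.
by rewrite big1 // => y _; rewrite f0 mul0r monalgU0.
Qed.

Lemma ga_mulDl : left_distributive ga_mul +%R.
Proof.
move=> f1 f2 g.
rewrite (ga_mulw (msuppD_le f1 f2) (fsubset_refl _)).
rewrite (ga_mulw (fsubsetUl (msupp f1) (msupp f2)) (fsubset_refl _)).
rewrite (ga_mulw (fsubsetUr (msupp f1) (msupp f2)) (fsubset_refl _)).
rewrite -big_split /=; apply/eq_bigr=> x _.
rewrite -big_split /=; apply/eq_bigr=> y _.
by rewrite mcoeffD mulrDl monalgUD.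
Qed.

Lemma ga_mulDr : right_distributive ga_mul +%R.
Proof.
move=> f g1 g2.
rewrite (ga_mulw (fsubset_refl _) (msuppD_le g1 g2)).
rewrite (ga_mulw (fsubset_refl _) (fsubsetUl (msupp g1) (msupp g2))).
rewrite (ga_mulw (fsubset_refl _) (fsubsetUr (msupp g1) (msupp g2))).
rewrite -big_split /=; apply/eq_bigr=> x _.
rewrite -big_split /=; apply/eq_bigr=> y _.
by rewrite mcoeffD mulrDr monalgUD.
Qed.

Lemma ga_mul0l g : ga_mul 0 g = 0.
Proof. by rewrite /ga_mul msupp0 big_seq_fset0. Qed.

Lemma ga_mul0r g : ga_mul g 0 = 0.
Proof. by rewrite /ga_mul big1 // => x _; rewrite msupp0 big_seq_fset0. Qed.

Lemma ga_mulUU a b x y :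
  ga_mul << a *g x >> << b *g y >> = << a * b *g (x * y)%g >>.
Proof.
by rewrite (ga_mulw msuppU_le msuppU_le) !big_seq_fset1 !mcoeffUU.
Qed.

Lemma ga_mul_suml I (r : seq I) (F : I -> KH) g :
  ga_mul (\sum_(i <- r) F i) g = \sum_(i <- r) ga_mul (F i) g.
Proof.
exact: (big_morph (ga_mul^~ g) (fun _ _ => ga_mulDl _ _ _) (ga_mul0l g)).
Qed.

Lemma ga_mul_sumr I (r : seq I) (F : I -> KH) g :
  ga_mul g (\sum_(i <- r) F i) = \sum_(i <- r) ga_mul g (F i).
Proof.
exact: (big_morph (ga_mul g) (fun _ _ => ga_mulDr _ _ _) (ga_mul0r g)).
Qed.

Lemma ga_mulA : associative ga_mul.
Proof.
move=> f g h; rewrite (monalgE f) ga_mul_suml [X in _ = ga_mul X _]ga_mul_suml.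
rewrite [RHS]ga_mul_suml; apply/eq_bigr=> x _.
rewrite (monalgE g) [X in ga_mul _ X = _]ga_mul_suml [LHS]ga_mul_sumr.
rewrite [X in _ = ga_mul X _]ga_mul_sumr [RHS]ga_mul_suml; apply/eq_bigr=> y _.
rewrite (monalgE h) [X in ga_mul _ X = _]ga_mul_sumr [LHS]ga_mul_sumr.
rewrite [RHS]ga_mul_sumr; apply/eq_bigr=> z _.
by rewrite !ga_mulUU mulrA mulgA.
Qed.

Lemma ga_mul1l : left_id ga_one ga_mul.
Proof.
move=> f; rewrite [in LHS](monalgE f) ga_mul_sumr [RHS]monalgE.
by apply/eq_bigr=> x _; rewrite ga_mulUU mul1r mul1g.
Qed.

Lemma ga_mul1r : right_id ga_one ga_mul.
Proof.
move=> f; rewrite [in LHS](monalgE f) ga_mul_suml [RHS]monalgE.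
by apply/eq_bigr=> x _; rewrite ga_mulUU mulr1 mulg1.
Qed.

Lemma ga_one_neq0 : ga_one != 0.
Proof. by rewrite monalgU_eq0 oner_eq0. Qed.

HB.instance Definition _ := GRing.Zmodule_isNzRing.Build KH
  ga_mulA ga_mul1l ga_mul1r ga_mulDl ga_mulDr ga_one_neq0.

Lemma ga_scaleU a b x : a *: (<< b *g x >> : KH) = << a * b *g x >>.
Proof. by apply/malgP=> y; rewrite mcoeffZ !mcoeffU mulrnAr. Qed.

Lemma ga_scaleAl a f g : a *: (f * g) = (a *: f) * g.
Proof.
rewrite -![(_ * _ : KH)]/(ga_mul _ _) (monalgE f) ga_mul_suml !scaler_sumr.
rewrite [RHS]ga_mul_suml; apply/eq_bigr=> x _; rewrite ga_scaleU (monalgE g).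
rewrite !ga_mul_sumr scaler_sumr; apply/eq_bigr=> y _.
by rewrite !(ga_scaleU, ga_mulUU) mulrA.
Qed.

HB.instance Definition _ := GRing.Lmodule_isLalgebra.Build K KH ga_scaleAl.

Lemma ga_scaleAr a f g : a *: (f * g) = f * (a *: g).
Proof.
rewrite -![(_ * _ : KH)]/(ga_mul _ _) (monalgE f) !ga_mul_suml scaler_sumr.
apply/eq_bigr=> x _; rewrite (monalgE g) [X in _ *: X]ga_mul_sumr [LHS]scaler_sumr.
rewrite [X in _ = ga_mul _ X]scaler_sumr [RHS]ga_mul_sumr.
apply/eq_bigr=> y _.
by rewrite !(ga_scaleU, ga_mulUU) mulrCA.
Qed.

HB.instance Definition _ := GRing.Lalgebra_isAlgebra.Build K KH ga_scaleAr.

End GroupAlgebra.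

(* The library makes ['M[R]_n] an R-module; the alias carries the K-algebra
   structure. *)
Definition matrix_algebra (K : fieldType) (R : algType K) (n : nat) : Type :=
  'M[R]_n.+1.

Section MatrixAlgebra.
Variables (K : fieldType) (R : algType K) (n : nat).
Local Notation M := (matrix_algebra R n).

HB.instance Definition _ := GRing.NzRing.copy M 'M[R]_n.+1.

Definition mxa_scale (k : K) (X : M) : M := k%:A *: (X : 'M[R]_n.+1).

Lemma mxa_scaleE k (X : M) i j : mxa_scale k X i j = k *: X i j.
Proof. by rewrite mxE mulr_algl. Qed.

Fact mxa_scaleA k l (X : M) :
  mxa_scale k (mxa_scale l X) = mxa_scale (k * l) X.
Proof. by apply/matrixP=> i j; rewrite !mxa_scaleE scalerA. Qed.

Fact mxa_scale1 : left_id 1 mxa_scale.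
Proof. by move=> X; apply/matrixP=> i j; rewrite !mxa_scaleE scale1r. Qed.

Fact mxa_scaleDr : right_distributive mxa_scale +%R.
Proof.
by move=> k X Y; apply/matrixP=> i j; rewrite [RHS]mxE !mxa_scaleE mxE scalerDr.
Qed.

Fact mxa_scaleDl (X : M) : {morph mxa_scale^~ X : k l / k + l}.
Proof.
by move=> k l; apply/matrixP=> i j; rewrite [RHS]mxE !mxa_scaleE scalerDl.
Qed.

HB.instance Definition _ := GRing.Zmodule_isLmodule.Build K M
  mxa_scaleA mxa_scale1 mxa_scaleDr mxa_scaleDl.

Fact mxa_scaleAl (k : K) (X Y : M) : k *: (X * Y) = (k *: X) * Y.
Proof. exact: scalemxAl. Qed.

HB.instance Definition _ := GRing.Lmodule_isLalgebra.Build K M mxa_scaleAl.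

Fact mxa_scaleAr (k : K) (X Y : M) : k *: (X * Y) = X * (k *: Y).
Proof.
apply/matrixP=> i j; rewrite [LHS]mxa_scaleE !mxE scaler_sumr.
by apply: eq_bigr => l _; rewrite [in RHS]mxa_scaleE scalerAr.
Qed.

HB.instance Definition _ := GRing.Lalgebra_isAlgebra.Build K M mxa_scaleAr.

End MatrixAlgebra.

(* K^n with the componentwise product; an alias, because {ffun _ -> K} is not a
   nonzero ring in general *)
Definition power_algebra (K : fieldType) (n : nat) : Type :=
  {ffun 'I_n.+1 -> K}.

Section PowerAlgebra.
Variables (K : fieldType) (n : nat).
Local Notation Kn := (power_algebra K n).

HB.instance Definition _ := GRing.PzRing.copy Kn {ffun 'I_n.+1 -> K}.
HB.instance Definition _ := GRing.PzSemiRing_isNonZero.Build Kn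
  (@ffun1_nonzero _ K (ord0 : 'I_n.+1)).
HB.instance Definition _ := GRing.Lmodule.copy Kn {ffun 'I_n.+1 -> K^o}.

Fact pwa_scaleAl (k : K) (u v : Kn) : k *: (u * v) = (k *: u) * v.
Proof. by apply/ffunP=> i; rewrite !ffunE; exact: mulrA. Qed.

HB.instance Definition _ := GRing.Lmodule_isLalgebra.Build K Kn pwa_scaleAl.

Fact pwa_scaleAr (k : K) (u v : Kn) : k *: (u * v) = u * (k *: v).
Proof. by apply/ffunP=> i; rewrite !ffunE; exact: mulrCA. Qed.

HB.instance Definition _ := GRing.Lalgebra_isAlgebra.Build K Kn pwa_scaleAr.

End PowerAlgebra.

Record two_sided_ideal (K : fieldType) (R : algType K) (I : set R) : Prop := {
  ideal0 : I 0;
  idealD : forall x y, I x -> I y -> I (x + y);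
  idealZ : forall (k : K) x, I x -> I (k *: x);
  idealMl : forall r x, I x -> I (r * x);
  idealMr : forall x r, I x -> I (x * r) }.

(* [pa_map g] stands for alpha_g : D_(g^-1) -> D_g; it is encoded as a total
   function whose values outside D_(g^-1) are irrelevant.  Accordingly, the set
   alpha_h^-1 (D_h `&` D_(g^-1)) is the set [pa_comp_dom] below. *)
Definition pa_comp_dom (G : groupType) (T : Type) (D : G -> set T)
    (act : G -> T -> T) (g h : G) : set T :=
  D h^-1%g `&` act h @^-1` (D h `&` D g^-1%g).

Record partial_action (G : groupType) (K : fieldType) (R : algType K) := {
  pa_dom : G -> set R;
  pa_map : G -> R -> R;
  pa_ideal : forall g, two_sided_ideal (pa_dom g);
  pa_bij : forall g, set_bij (pa_dom g^-1%g) (pa_dom g) (pa_map g);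
  pa_mapD : forall g, {in pa_dom g^-1%g &, {morph pa_map g : x y / x + y}};
  pa_mapZ : forall g (k : K),
    {in pa_dom g^-1%g, {morph pa_map g : x / k *: x}};
  pa_mapM : forall g, {in pa_dom g^-1%g &, {morph pa_map g : x y / x * y}};
  pa_dom1 : pa_dom 1%g = setT;
  pa_map1 : forall x, pa_map 1%g x = x;
  pa_domM : forall g h,
    pa_comp_dom pa_dom pa_map g h `<=` pa_dom (g * h)^-1%g;
  pa_mapMg : forall g h x, pa_comp_dom pa_dom pa_map g h x ->
    pa_map g (pa_map h x) = pa_map (g * h)%g x }.

Section SkewGroupRing.
Variables (G : groupType) (K : fieldType) (R : algType K).
Variable alpha : partial_action G R.
Local Notation D := (pa_dom alpha).
Local Notation act := (pa_map alpha).

Definition skew_pred : {pred {malg R[G]}} :=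
  fun a => `[< forall g, D g a@_g >].

(* [skew_val a] is the finitely supported family g |-> a_g, representing the
   formal sum of the a_g delta_g. *)
Record skew_group_ring := Skew {
  skew_val : {malg R[G]};
  _ : skew_pred skew_val }.

HB.instance Definition _ := [isSub for skew_val].
HB.instance Definition _ := [Choice of skew_group_ring by <:].

Lemma skew_predP (a : {malg R[G]}) :
  reflect (forall g, D g a@_g) (a \in skew_pred).
Proof. exact: asboolP. Qed.

Lemma skew_valP (a : skew_group_ring) g : D g (skew_val a)@_g.
Proof. by case: a => a /= /asboolP. Qed.

Fact skew_zmod_closed : zmod_closed skew_pred.
Proof.
split=> [|a b /skew_predP Da /skew_predP Db]; apply/skew_predP => g.
  by rewrite mcoeff0; exact: ideal0 (pa_ideal _ _).
have I := pa_ideal alpha g; rewrite mcoeffB -scaleN1r.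
by apply: (idealD I) => //; exact: (idealZ I).
Qed.

HB.instance Definition _ := GRing.isZmodClosed.Build _ skew_pred
  skew_zmod_closed.
HB.instance Definition _ := [SubChoice_isSubZmodule of skew_group_ring by <:].

Lemma skew_valD a b : skew_val (a + b) = skew_val a + skew_val b.
Proof. by []. Qed.

Definition skew_scale_val (k : K) (a : {malg R[G]}) : {malg R[G]} := k%:A *: a.

Lemma skew_scale_valE k a g : (skew_scale_val k a)@_g = k *: a@_g.
Proof. by rewrite mcoeffZ mulr_algl. Qed.

Fact skew_scale_subproof k (a : skew_group_ring) :
  skew_pred (skew_scale_val k (skew_val a)).
Proof.
apply/skew_predP => g; rewrite skew_scale_valE.
by apply: idealZ (skew_valP a g); exact: pa_ideal.
Qed.

Definition skew_scale k a : skew_group_ring := Skew (skew_scale_subproof k a).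

Fact skew_scaleA k l a : skew_scale k (skew_scale l a) = skew_scale (k * l) a.
Proof.
by apply/val_inj/malgP => g; rewrite /= !skew_scale_valE scalerA.
Qed.

Fact skew_scale1 : left_id 1 skew_scale.
Proof.
by move=> a; apply/val_inj/malgP => g; rewrite /= !skew_scale_valE scale1r.
Qed.

Fact skew_scaleDr : right_distributive skew_scale +%R.
Proof.
move=> k a b; apply/val_inj/malgP => g.
by rewrite [LHS]skew_scale_valE !skew_valD !mcoeffD !skew_scale_valE scalerDr.
Qed.

Fact skew_scaleDl a : {morph skew_scale^~ a : k l / k + l}.
Proof.
move=> k l; apply/val_inj/malgP => g.
rewrite [LHS]skew_scale_valE scalerDl -!skew_scale_valE -mcoeffD.
by [].

Qed.

HB.instance Definition _ := GRing.Zmodule_isLmodule.Build K skew_group_ring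
  skew_scaleA skew_scale1 skew_scaleDr skew_scaleDl.

(* The product is associative only under extra assumptions on alpha, so no ring
   structure is declared. *)
Definition skew_mul_val (a b : {malg R[G]}) : {malg R[G]} :=
  \sum_(g <- msupp a) \sum_(h <- msupp b)
     << act g (act g^-1%g a@_g * b@_h) *g (g * h)%g >>.

Lemma skew_mul_dom g h x y : D g x -> D h y ->
  D (g * h)%g (act g (act g^-1%g x * y)).
Proof.
move=> Dx Dy.
have Dx' : D g^-1%g (act g^-1%g x).
  by have [+ _ _] := pa_bij alpha g^-1%g; apply; rewrite invgK.
set z := _ * y.
have Dz : D g^-1%g z by apply: idealMr => //; exact: pa_ideal.
have Dz' : D h z by apply: idealMl => //; exact: pa_ideal.
have Daz : D g (act g z).
  by have [+ _ _] := pa_bij alpha g; exact.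
have gz : act g^-1%g (act g z) = z.
  rewrite pa_mapMg ?mulVg ?pa_map1 //.
  by split=> //; split => //=; rewrite ?invgK.
have := @pa_domM _ _ _ alpha h^-1%g g^-1%g (act g z).
by rewrite invgM !invgK; apply; rewrite /pa_comp_dom !invgK /= gz.
Qed.

Fact skew_mul_subproof (a b : skew_group_ring) :
  skew_pred (skew_mul_val (skew_val a) (skew_val b)).
Proof.
apply: (@rpred_sum _ skew_pred) => g _; apply: rpred_sum => h _.
apply/skew_predP => x; rewrite mcoeffU.
case: eqP => [<-|_]; last by rewrite mulr0n; exact: ideal0 (pa_ideal _ _).
by rewrite mulr1n; apply: skew_mul_dom; exact: skew_valP.
Qed.

Definition skew_mul a b : skew_group_ring := Skew (skew_mul_subproof a b).

End SkewGroupRing.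

Section PartialRepresentation.
Variables (G : groupType) (K : fieldType) (B : algType K).
Variable pi : G -> B.

Definition partial_representation : Prop :=
  [/\ pi 1%g = 1,
      forall g h, pi g * pi h * pi h^-1%g = pi (g * h)%g * pi h^-1%g
    & forall g h, pi g^-1%g * pi g * pi h = pi g^-1%g * pi (g * h)%g].

Definition prep_idem (g : G) : B := pi g * pi g^-1%g.

(* [GRing.subalg_closed] is unital, which is harmless: prep_idem 1 = 1. *)
Definition prep_algebra : set B :=
  smallest (fun S : set B => GRing.subalg_closed (mem S)) (range prep_idem).

Definition prep_dom (g : G) : set B := [set prep_idem g * a | a in prep_algebra].

Definition prep_map (g : G) (a : B) : B := pi g * a * pi g^-1%g.

End PartialRepresentation.

Section Translates.
Variable G : groupType.
Implicit Types (A : set G) (g h : G).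

Definition ltrans g A : set G := [set (g * x)%g | x in A].
Definition rtrans A g : set G := [set (x * g)%g | x in A].

Lemma ltransM g h A : ltrans g (ltrans h A) = ltrans (g * h)%g A.
Proof.
apply/seteqP; split=> [_ [_ [x Ax <-] <-]|_ [x Ax <-]].
  by exists x => //; rewrite mulgA.
by exists (h * x)%g; [exists x | rewrite mulgA].
Qed.

Lemma ltrans1 A : ltrans 1%g A = A.
Proof.
by apply/seteqP; split=> [_ [x Ax <-]|x Ax]; [rewrite mul1g|exists x; rewrite ?mul1g].
Qed.

Lemma ltransP g A x : ltrans g A x <-> A (g^-1 * x)%g.
Proof.
by split=> [[y Ay <-]|Ax]; [rewrite mulKg | exists (g^-1 * x)%g; rewrite ?mulVKg].
Qed.

Definition stab A : set G := [set h | ltrans h A = A].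

Definition stab_pred A : {pred G} := mem (stab A).

Fact stab_group_closed A : group_closed (stab_pred A).
Proof.
split=> [|g h]; rewrite !inE /stab /=; first exact: ltrans1.
by move=> Ag Ah; rewrite -{1}Ah ltransM mulgVK.
Qed.

Definition stab_type A : Type := {h : G | stab_pred A h}.

HB.instance Definition _ A := SubChoice.on (stab_type A).
HB.instance Definition _ A :=
  SubChoice_isSubGroup.Build G (stab_pred A) (stab_type A)
    (stab_group_closed A).

Definition stab_group A : subGroupType (stab_pred A) := stab_type A.

End Translates.

(* The set A, the enumeration A_1, ..., A_n of its translates and the chosen
   g_1, ..., g_n.  Here n = ed_n.+1, because the index (A : H) is positive as
   1 is in A; the indices 1, ..., n become the elements of ['I_ed_n.+1]. *)
Record elementary_data (G : groupType) := {
  ed_set : set G;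
  ed_set1 : ed_set 1%g;
  ed_n : nat;
  ed_index : [set rtrans (stab ed_set) x | x in ed_set] #= `I_ed_n.+1;
  ed_obj : 'I_ed_n.+1 -> set G;
  ed_obj_inj : injective ed_obj;
  ed_obj_range :
    range ed_obj = [set ltrans g ed_set | g in [set g | ed_set g^-1%g]];
  ed_obj0 : ed_obj ord0 = ed_set;
  ed_elt : 'I_ed_n.+1 -> G;
  ed_eltP : forall i, ltrans (ed_elt i) ed_set = ed_obj i }.

Section Elementary.
Variables (K : fieldType) (G : groupType) (d : elementary_data G).
Local Notation A := (ed_set d).
Local Notation I := ('I_(ed_n d).+1).
Local Notation A_ := (@ed_obj G d).
Local Notation g_ := (@ed_elt G d).
Local Notation H := (stab_group A).
Definition stab_algebra : algType K := group_algebra K H.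
Local Notation KH := stab_algebra.
Local Notation M := (matrix_algebra KH (ed_n d)).
Local Notation Kn := (power_algebra K (ed_n d)).

(* The morphism (A_i, g) of the groupoid Gamma is encoded as the pair (i, g). *)
Definition arrow_pred (u : I * G) : bool :=
  `[< exists j, ltrans u.2 (A_ u.1) = A_ j >].

Definition arrow : Type := {u : I * G | arrow_pred u}.
HB.instance Definition _ := SubChoice.on arrow.

Definition arrow_src (u : arrow) : I := (val u).1.
Definition arrow_elt (u : arrow) : G := (val u).2.
Definition arrow_tgt (u : arrow) : I := projT1 (cid (asboolP _ (valP u))).

Lemma arrow_tgtP u : ltrans (arrow_elt u) (A_ (arrow_src u)) = A_ (arrow_tgt u).
Proof. by rewrite /arrow_tgt; case: cid. Qed.

(* The K-module underlying the groupoid algebra; the product of the latter is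
   not involved in the definition of [elem_rep]. *)
Definition groupoid_module : Type := {malg K[arrow]}.
HB.instance Definition _ := GRing.Lmodule.copy groupoid_module {malg K[arrow]}.

Definition elem_lambda (g : G) : groupoid_module :=
  \sum_(i | g^-1%g \in A_ i) oapp (fun u : arrow => << u >>) 0 (insub (i, g)).

Lemma arrow_stab_subproof (u : arrow) :
  stab_pred A ((g_ (arrow_tgt u))^-1 * arrow_elt u * g_ (arrow_src u))%g.
Proof.
rewrite /stab_pred inE /stab /= -!ltransM ed_eltP arrow_tgtP.
by rewrite -ed_eltP ltransM mulVg ltrans1.
Qed.

Definition arrow_stab (u : arrow) : H := Sub _ (arrow_stab_subproof u).

Definition elem_tau (f : groupoid_module) : M :=
  \sum_(u <- msupp f) f@_u *:
     ((<< arrow_stab u >> : KH) *: delta_mx (arrow_tgt u) (arrow_src u) : M).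

Definition elem_rep (g : G) : M := elem_tau (elem_lambda g).

Definition elem_diag (v : Kn) : M := diag_mx (\row_i (v i)%:A).
(* The inverse of [elem_diag] on scalar diagonal matrices: the coefficient of
   1 in each diagonal entry. *)
Definition elem_undiag (X : M) : Kn := [ffun i => (X i i)@_1%g].

Lemma ed_obj1 i : A_ i 1%g.
Proof.
have : range A_ (A_ i) by exists i.
by rewrite ed_obj_range => -[g Ag <-]; apply/ltransP; rewrite mulg1.
Qed.

Lemma ed_obj_trans g i : (exists k, ltrans g (A_ i) = A_ k) <-> A_ i g^-1%g.
Proof.
split=> [[k gi]|Ag].
  by have := ed_obj1 k; rewrite -gi => /ltransP; rewrite mulg1.
suff : range A_ (ltrans g (A_ i)) by case=> k _ <-; exists k.
rewrite ed_obj_range; exists (g * g_ i)%g; last by rewrite -ltransM ed_eltP.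
by move: Ag; rewrite -ed_eltP => /ltransP /=; rewrite invgM.
Qed.

Definition stab_basis (x : G) : KH := oapp (fun h : H => << h >>) 0 (insub x).

Lemma stab_basis0 x : ~ stab A x -> stab_basis x = 0.
Proof. by move=> Hx; rewrite /stab_basis insubF //; apply/negP; rewrite inE. Qed.

Lemma stab_basisE (h : H) : stab_basis (val h) = << h >>.
Proof. by rewrite /stab_basis valK. Qed.

Lemma stab_basis1 : stab_basis 1%g = 1.
Proof. exact: (stab_basisE (1%g : H)). Qed.

Lemma stab_basisM x y : stab A x -> stab A y ->
  stab_basis (x * y)%g = stab_basis x * stab_basis y.
Proof.
move=> /mem_set Hx /mem_set Hy.
pose h : H := Sub x Hx; pose k : H := Sub y Hy.
rewrite -[x]/(val h) -[y]/(val k).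
by rewrite -[(val h * val k)%g]/(val (h * k)%g) !stab_basisE [RHS]ga_mulUU mulr1.
Qed.

Lemma stab_trans g i j :
  stab A ((g_ i)^-1 * g * g_ j)%g <-> ltrans g (A_ j) = A_ i.
Proof.
rewrite /stab /= -!ltransM ed_eltP; split=> [eA|->]; last first.
  by rewrite -ed_eltP ltransM mulVg ltrans1.
by rewrite -[RHS]ed_eltP -eA ltransM mulgV ltrans1.
Qed.

Lemma elem_tau_is_additive (f1 f2 : groupoid_module) :
  elem_tau (f1 + f2) = elem_tau f1 + elem_tau f2.
Proof.
pose F (f : groupoid_module) u : M := f@_u *:
  ((<< arrow_stab u >> : KH) *: delta_mx (arrow_tgt u) (arrow_src u) : M).
have tauw (S : {fset arrow}) (f : groupoid_module) : (msupp f `<=` S)%fset ->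
    elem_tau f = \sum_(u <- S) F f u.
  move=> le; rewrite /elem_tau (big_fset_incl _ le) //= => u _ /mcoeff_outdom f0.
  by rewrite f0 scale0r.
rewrite (tauw _ _ (msuppD_le f1 f2)).
rewrite (tauw _ _ (fsubsetUl (msupp f1) (msupp f2))).
rewrite (tauw _ _ (fsubsetUr (msupp f1) (msupp f2))) -big_split /=.
by apply: eq_bigr => u _; rewrite /F mcoeffD scalerDl.
Qed.

Lemma elem_tau0 : elem_tau 0 = 0.
Proof. by rewrite /elem_tau msupp0 big_seq_fset0. Qed.

Lemma elem_tauU (u : arrow) : elem_tau << u >> =
  (<< arrow_stab u >> : KH) *: delta_mx (arrow_tgt u) (arrow_src u) :> 'M_(_).
Proof.
by rewrite /elem_tau msuppU oner_eq0 big_seq_fset1 mcoeffUU scale1r.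
Qed.

Lemma elem_repE g i j :
  (elem_rep g : 'M_(_)) i j = stab_basis ((g_ i)^-1 * g * g_ j)%g.
Proof.
rewrite /elem_rep /elem_lambda.
rewrite (big_morph elem_tau elem_tau_is_additive elem_tau0) summxE.
have term k : g^-1%g \in A_ k ->
    (elem_tau (oapp (fun u : arrow => << u >>) 0 (insub (k, g))) : 'M_(_)) i j =
    if k == j then stab_basis ((g_ i)^-1 * g * g_ j)%g else 0.
  rewrite inE => /ed_obj_trans gk.
  have Hu : arrow_pred (k, g) by apply/asboolP.
  pose u : arrow := Sub (k, g) Hu.
  rewrite (insubT arrow_pred Hu) -/u /= elem_tauU !mxE.
  have su : arrow_src u = k by [].
  have gu : arrow_elt u = g by [].
  have tu : ltrans g (A_ k) = A_ (arrow_tgt u) by exact: (arrow_tgtP u).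
  rewrite su [j == k]eq_sym; case: (k =P j) => [<-|_]; last by rewrite andbF mulr0.
  rewrite andbT; case: (i =P arrow_tgt u) => [->|ne].
    by rewrite mulr1 -stab_basisE /= su gu.
  rewrite mulr0 stab_basis0 // => /stab_trans; rewrite tu => /ed_obj_inj.
  by move=> e; apply: ne.
rewrite (eq_bigr _ term) -big_mkcondr /=.
have [gj|gj] := boolP (g^-1%g \in A_ j).
  by rewrite (bigD1 j) ?gj ?eqxx //= big1 ?addr0 // => k /andP[/andP[_ ->]].
rewrite stab_basis0 => [|/stab_trans e]; last first.
  by case/negP: gj; rewrite inE; apply/ed_obj_trans; exists i.
by rewrite big1 // => k /andP[gk /eqP kj]; rewrite -kj gk in gj.
Qed.

Lemma elem_diag_mx (v : Kn) i j :
  (elem_diag v : 'M_(_)) i j = if i == j then (v i)%:A else 0.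
Proof. by rewrite !mxE; case: eqP => [->|_]; rewrite ?mulr1n ?mulr0n. Qed.

Lemma elem_diagK : cancel elem_diag elem_undiag.
Proof.
move=> v; apply/ffunP=> i; rewrite ffunE elem_diag_mx eqxx mcoeffZ.
by rewrite mcoeffUU mulr1.
Qed.

Lemma mul_elem_diag (v : Kn) (X : M) i j :
  (elem_diag v * X : 'M_(_)) i j = v i *: (X : 'M_(_)) i j.
Proof.
rewrite mxE (bigD1 i) //= big1 ?addr0 => [|k /negPf ki].
  by rewrite elem_diag_mx eqxx mulr_algl.
by rewrite elem_diag_mx eq_sym ki mul0r.
Qed.

Lemma mul_mx_elem_diag (v : Kn) (X : M) i j :
  (X * elem_diag v : 'M_(_)) i j = v j *: (X : 'M_(_)) i j.
Proof.
rewrite mxE (bigD1 j) //= big1 ?addr0 => [|k /negPf ki].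
  by rewrite elem_diag_mx eqxx mulr_algr.
by rewrite elem_diag_mx ki mulr0.
Qed.

Lemma elem_diag1 : elem_diag 1 = 1.
Proof.
apply/matrixP=> i j; rewrite elem_diag_mx ffunE !mxE.
by case: eqP => _; rewrite ?scale1r.
Qed.

Lemma elem_diagM : {morph elem_diag : u v / u * v}.
Proof.
move=> u v; apply/matrixP=> i j; rewrite elem_diag_mx.
transitivity (u i *: (elem_diag v : 'M_(_)) i j); last first.
  by apply/esym; exact: mul_elem_diag.
rewrite elem_diag_mx; case: (i =P j) => _; last by rewrite scaler0.
have -> : (u * v) i = u i * v i by rewrite ffunE.
by rewrite scalerA.
Qed.

Lemma elem_diag_is_linear : linear elem_diag.
Proof.
move=> k u v; apply/matrixP=> i j; rewrite elem_diag_mx.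
transitivity (k *: (elem_diag u : 'M_(_)) i j + (elem_diag v : 'M_(_)) i j).
  rewrite -> (elem_diag_mx u i j), (elem_diag_mx v i j).
  case: (i =P j) => _; last by rewrite scaler0 addr0.
  have -> : (k *: u + v) i = k * u i + v i by rewrite !ffunE.
  by rewrite scalerDl scalerA.
by rewrite [RHS]mxE; congr (_ + _); apply/esym; exact: mxa_scaleE.
Qed.

HB.instance Definition _ :=
  GRing.isLinear.Build K Kn M *:%R elem_diag elem_diag_is_linear.

Definition obj_ind (g : G) : Kn := [ffun i => (g \in A_ i)%:R].

Lemma mul_elem_rep (X : M) h i j : (X * elem_rep h : 'M_(_)) i j =
  \sum_k (X : 'M_(_)) i k * stab_basis ((g_ k)^-1 * h * g_ j)%g.
Proof. by rewrite mxE; apply: eq_bigr => k _; congr (_ * _); exact: elem_repE. Qed.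

Lemma stab_basisMr x y : stab A y ->
  stab_basis (x * y)%g = stab_basis x * stab_basis y.
Proof.
move=> Hy; have [Hx|Hx] := pselect (stab A x); first exact: stab_basisM.
rewrite (stab_basis0 Hx) mul0r stab_basis0 // => Hxy; apply: Hx.
by move: Hy Hxy; rewrite /stab /= => Hy Hxy; rewrite -[in LHS]Hy ltransM.
Qed.

Lemma elem_repM g h :
  elem_rep g * elem_rep h = elem_rep (g * h)%g * elem_diag (obj_ind h^-1%g).
Proof.
apply/matrixP=> i j.
transitivity ((obj_ind h^-1%g j) *: stab_basis ((g_ i)^-1 * (g * h) * g_ j)%g);
  last first.
  by rewrite -elem_repE; apply/esym; exact: mul_mx_elem_diag.
have -> : obj_ind h^-1%g j = (h^-1%g \in A_ j)%:R by rewrite ffunE.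
transitivity (\sum_k stab_basis ((g_ i)^-1 * g * g_ k)%g *
                      stab_basis ((g_ k)^-1 * h * g_ j)%g).
  rewrite (mul_elem_rep (elem_rep g)); apply: eq_bigr => k _; congr (_ * _).
  exact: elem_repE.
have [hj|hj] := boolP (h^-1%g \in A_ j); last first.
  rewrite scale0r big1 // => k _.
  rewrite (@stab_basis0 ((g_ k)^-1 * h * g_ j)%g) ?mulr0 //.
  by move/stab_trans=> e; case/negP: hj; rewrite inE; apply/ed_obj_trans; exists k.
rewrite scale1r; move: hj; rewrite inE => /ed_obj_trans[k ek].
have Hk : stab A ((g_ k)^-1 * h * g_ j)%g by apply/stab_trans.
rewrite (bigD1 k) //= big1 ?addr0 => [|l lk].
  by rewrite -(stab_basisMr _ Hk); congr stab_basis; rewrite !mulgA mulgK.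
rewrite (@stab_basis0 ((g_ l)^-1 * h * g_ j)%g) ?mulr0 // => /stab_trans.
by rewrite ek => /ed_obj_inj kl; rewrite kl eqxx in lk.
Qed.

Lemma elem_rep1 : elem_rep 1%g = 1.
Proof.
apply/matrixP=> i j; rewrite elem_repE mulg1 mxE.
have [->|ij] := eqVneq i j; first by rewrite mulVg stab_basis1.
rewrite stab_basis0 // => H1.
have : ltrans 1%g (A_ j) = A_ i by apply/stab_trans; rewrite mulg1.
by rewrite ltrans1 => /ed_obj_inj ji; rewrite ji eqxx in ij.
Qed.

Lemma elem_idemE g : prep_idem elem_rep g = elem_diag (obj_ind g).
Proof.
by rewrite /prep_idem elem_repM mulgV elem_rep1 mul1r invgK.
Qed.

Lemma elem_idem_V g :
  elem_rep g^-1%g * elem_rep g = elem_diag (obj_ind g^-1%g).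
Proof. by rewrite -elem_idemE /prep_idem invgK. Qed.

Lemma elem_rep_indl g : elem_diag (obj_ind g) * elem_rep g = elem_rep g.
Proof.
apply/matrixP=> i j; rewrite mul_elem_diag elem_repE ffunE.
case: (boolP (g \in _)) => [_|gi]; first by rewrite scale1r.
rewrite scale0r stab_basis0 // => /stab_trans e; case/negP: gi.
by rewrite inE -e; apply/ltransP; rewrite mulVg; exact: ed_obj1.
Qed.

Lemma elem_rep_partial : partial_representation elem_rep.
Proof.
split=> [|g h|g h]; first exact: elem_rep1.
  have gen (R : nzRingType) (a b c e f : R) :
    a * b = c * e -> e * f = f -> a * b * f = c * f.
    by move=> -> ef; rewrite -mulrA ef.
  exact: gen (elem_repM g h) (elem_rep_indl h^-1%g).
transitivity (elem_diag (obj_ind g^-1%g) * elem_rep h).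
  by congr (_ * _); exact: (elem_idem_V g).
transitivity (elem_rep h * elem_diag (obj_ind (g * h)^-1%g)); last first.
  have gen (R : nzRingType) (a b c e f : R) : a * b = c * e -> c = f ->
    f * e = a * b by move=> -> <-.
  exact: (gen _ _ _ _ _ _ (elem_repM g^-1%g (g * h)%g)
    (congr1 elem_rep (mulKg g h))).
apply/matrixP=> i j.
transitivity (obj_ind g^-1%g i *: stab_basis ((g_ i)^-1 * h * g_ j)%g).
  by rewrite -elem_repE; exact: mul_elem_diag.
transitivity (obj_ind (g * h)^-1%g j *: stab_basis ((g_ i)^-1 * h * g_ j)%g);
  last first.
  by rewrite -elem_repE; apply/esym; exact: mul_mx_elem_diag.
rewrite invgM !ffunE.
have [/stab_trans e|He] := pselect (stab A ((g_ i)^-1 * h * g_ j)%g).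
  suff -> : (g^-1%g \in A_ i) = ((h^-1 * g^-1)%g \in A_ j) by [].
  apply/idP/idP; rewrite !inE -e; first by move/ltransP.
  by move=> ?; apply/ltransP.
by rewrite (stab_basis0 He) !scaler0.
Qed.

Lemma elem_subalg_full (S : set Kn) :
  GRing.subalg_closed (mem S) -> (forall g, S (obj_ind g)) -> S = setT.
Proof.
case=> S1 SL SM Sind; apply/seteqP; split=> // v _.
have Z0 (k : K) u : u \in S -> k *: u \in S.
  have S0 : 0 \in S by rewrite -(subrr 1) addrC -scaleN1r; exact: SL.
  by move=> Su; rewrite -[_ *: _]addr0; exact: SL.
have S0 : 0 \in S by rewrite -(scale0r 1); exact: Z0.
have D u w : u \in S -> w \in S -> u + w \in S.
  by move=> Su Sw; rewrite -[u]scale1r; exact: SL.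
have sep i j : exists f, f \in S /\ (i != j -> f i = 1 /\ f j = 0).
  have [ij|ij] := eqVneq i j; first by exists 0.
  have [[g [gi gj]]|nex] := pselect (exists g, A_ i g /\ ~ A_ j g).
    exists (obj_ind g); split; first exact: mem_set.
    by move=> _; rewrite !ffunE mem_set // memNset.
  have [[g [gj gi]]|nex'] := pselect (exists g, A_ j g /\ ~ A_ i g).
    exists (-1 *: obj_ind g + 1); split; first by apply: SL => //; exact: mem_set.
    move=> _; rewrite !ffunE (mem_set gj) (memNset gi).
    by rewrite [_ *: _]mulr0 [_ *: _]mulr1 add0r addNr.
  case/eqP: ij; apply: (@ed_obj_inj _ d); apply/seteqP; split=> g gA.
    by apply: contrapT => ng; apply: nex; exists g.
  by apply: contrapT => ng; apply: nex'; exists g.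
pose f i j := projT1 (cid (sep i j)).
have fS i j : f i j \in S by rewrite /f; case: cid => ? [].
have fij i j : i != j -> f i j i = 1 /\ f i j j = 0.
  by rewrite /f; case: cid => ? [].
pose e i : Kn := \prod_(j | i != j) f i j.
have eS i : e i \in S.
  by apply: (big_ind (fun x : Kn => x \in S)) => // *; exact: SM.
have evalP i l : e i l = (l == i)%:R.
  have -> : e i l = \prod_(j | i != j) f i j l.
    apply: (big_morph (fun x : Kn => x l)) => [x y|]; by rewrite ffunE.
  have [->|li] := eqVneq l i; first by rewrite big1 // => j /fij[].
  rewrite (bigD1 l) 1?eq_sym //=.
  by rewrite eq_sym in li; have [_ ->] := fij i l li; rewrite mul0r.
have -> : v = \sum_i v i *: e i.
  apply/ffunP=> l; rewrite sum_ffunE (bigD1 l) //= big1 => [|k kl].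
    by rewrite addr0 ffunE evalP eqxx [_ *: _]mulr1.
  by rewrite ffunE evalP eq_sym (negPf kl) [_ *: _]mulr0.
apply: set_mem; apply: (big_ind (fun x : Kn => x \in S)) => // i _.
exact: Z0.
Qed.

Lemma elem_algebraE : prep_algebra elem_rep = range elem_diag.
Proof.
apply/seteqP; split.
  apply: smallest_sub => [|_ [g _ <-]]; last first.
    by rewrite elem_idemE; exists (obj_ind g).
  split=> [|k _ _ /set_mem[u _ <-] /set_mem[v _ <-]
          |_ _ /set_mem[u _ <-] /set_mem[v _ <-]]; apply: mem_set.
  - by exists 1 => //; exact: elem_diag1.
  - by exists (k *: u + v) => //; rewrite linearP.
  - by exists (u * v) => //; rewrite elem_diagM.
move=> _ [v _ <-] S [[S1 SL SM] Sgen].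
suff full : elem_diag @^-1` S = setT by have : (elem_diag @^-1` S) v by rewrite full.
apply: elem_subalg_full => [|g]; last first.
  by apply: Sgen; exists g => //; exact: elem_idemE.
split=> [|k u w /set_mem Su /set_mem Sw|u w /set_mem Su /set_mem Sw];
  apply: mem_set; rewrite /preimage /=.
- by have -> := elem_diag1; exact: set_mem S1.
- have -> := elem_diag_is_linear k u w.
  exact: set_mem (SL k _ _ (mem_set Su) (mem_set Sw)).
- have -> := elem_diagM u w.
  exact: set_mem (SM _ _ (mem_set Su) (mem_set Sw)).
Qed.

(* [obj_trans g i] is the index of g A_i, when g A_i is one of the A_j *)
Definition obj_trans (g : G) (i : I) : option I :=
  [pick k | `[< ltrans g (A_ i) = A_ k >]].

Lemma obj_transP g i k : obj_trans g i = Some k <-> ltrans g (A_ i) = A_ k.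
Proof.
rewrite /obj_trans; case: pickP => [l /asboolP e|no]; split=> [|e'] //.
- by case=> <-.
- by congr Some; apply: (@ed_obj_inj _ d); rewrite -e -e'.
- by have /asboolP := no k.
Qed.

Lemma obj_trans_None g i : obj_trans g i = None <-> ~ A_ i g^-1%g.
Proof.
split=> [e /ed_obj_trans[k /obj_transP]|ng]; first by rewrite e.
case e: obj_trans => [k|] //; case: ng; apply/ed_obj_trans.
by exists k; exact/obj_transP.
Qed.

Lemma obj_transM g h i k :
  obj_trans h i = Some k -> obj_trans (g * h)%g i = obj_trans g k.
Proof.
by move=> /obj_transP e; rewrite /obj_trans -ltransM e.
Qed.

(* The partial action on [prep_algebra elem_rep], transported to K^n along
   [elem_diag]; see [elem_algebraE] and [elem_pa_mapK]. *)
Definition elem_pa_dom (g : G) : set Kn :=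
  elem_diag @^-1` prep_dom elem_rep g.

Definition elem_pa_map (g : G) (v : Kn) : Kn :=
  elem_undiag (prep_map elem_rep g (elem_diag v)).

Lemma elem_pa_domP g v : elem_pa_dom g v <-> forall i, ~ A_ i g -> v i = 0.
Proof.
rewrite /elem_pa_dom /preimage /= /prep_dom elem_algebraE.
split=> [[_ [u _ <-] e] i ni|v0].
  move: e; have -> := elem_idemE g.
  have <- := elem_diagM (obj_ind g) u.
  by move/(can_inj elem_diagK) <-; rewrite !ffunE memNset // mul0r.
exists (elem_diag v); first by exists v.
have -> := elem_idemE g; have <- := elem_diagM (obj_ind g) v.
congr elem_diag; apply/ffunP=> i; rewrite !ffunE.
have [gi|ni] := pselect (A_ i g); first by rewrite (mem_set gi) mul1r.
by rewrite (memNset ni) mul0r v0.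
Qed.

Lemma prep_map_diag g v : prep_map elem_rep g (elem_diag v) =
  elem_diag [ffun i => oapp v 0 (obj_trans g^-1%g i)].
Proof.
apply/matrixP=> i j; rewrite /prep_map.
have -> := mul_elem_rep (elem_rep g * elem_diag v) g^-1%g i j.
transitivity (\sum_k v k *: (stab_basis ((g_ i)^-1 * g * g_ k)%g *
                             stab_basis ((g_ k)^-1 * g^-1 * g_ j)%g)).
  apply: eq_bigr => k _; rewrite scalerAl; congr (_ * _).
  by rewrite -elem_repE; exact: mul_mx_elem_diag.
have -> := elem_diag_mx [ffun i => oapp v 0 (obj_trans g^-1%g i)] i j.
rewrite ffunE.
have [/obj_trans_None nj|[k /obj_transP ek]] :
    obj_trans g^-1%g j = None \/ exists k, obj_trans g^-1%g j = Some k.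
  by case: obj_trans => [k|]; [right; exists k|left].
  rewrite big1 => [|k _].
    case: (i =P j) => // ->.
    by have /obj_trans_None -> := nj; rewrite scale0r.
  rewrite (@stab_basis0 ((g_ k)^-1 * g^-1 * g_ j)%g) ?mulr0 ?scaler0 //.
  by move/stab_trans=> e; apply: nj; apply/ed_obj_trans; exists k.
rewrite (bigD1 k) //= big1 ?addr0 => [|l lk]; last first.
  rewrite (@stab_basis0 ((g_ l)^-1 * g^-1 * g_ j)%g) ?mulr0 ?scaler0 //.
  by move/stab_trans; rewrite ek => /ed_obj_inj e; rewrite e eqxx in lk.
have Hk : stab A ((g_ k)^-1 * g^-1 * g_ j)%g by apply/stab_trans.
rewrite -(stab_basisMr _ Hk).
have -> : ((g_ i)^-1 * g * g_ k * ((g_ k)^-1 * g^-1 * g_ j) =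
           (g_ i)^-1 * 1 * g_ j)%g by rewrite !mulgA mulgK mulgK mulg1.
case: (i =P j) => [->|ij].
  by have /obj_transP -> := ek; rewrite mulg1 mulVg stab_basis1.
rewrite (@stab_basis0 ((g_ i)^-1 * 1 * g_ j)%g) ?scaler0 //.
by move/stab_trans; rewrite ltrans1 => /ed_obj_inj ji; apply: ij.
Qed.

Lemma elem_pa_mapE g v i : elem_pa_map g v i = oapp v 0 (obj_trans g^-1%g i).
Proof. by rewrite /elem_pa_map prep_map_diag elem_diagK ffunE. Qed.

Lemma elem_pa_mapK g v :
  elem_diag (elem_pa_map g v) = elem_rep g * elem_diag v * elem_rep g^-1%g.
Proof. by rewrite /elem_pa_map prep_map_diag elem_diagK -prep_map_diag. Qed.

Lemma elem_pa_map_in g v : elem_pa_dom g (elem_pa_map g v).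
Proof.
apply/elem_pa_domP => i ni; rewrite elem_pa_mapE.
by have /obj_trans_None -> : ~ A_ i (g^-1)^-1%g by rewrite invgK.
Qed.

Lemma elem_pa_map_id v : elem_pa_map 1%g v = v.
Proof.
apply/ffunP=> i; rewrite elem_pa_mapE.
by have /obj_transP -> : ltrans 1^-1%g (A_ i) = A_ i by rewrite invg1 ltrans1.
Qed.

Lemma elem_pa_map_Some g i k : obj_trans g^-1%g i = Some k ->
  forall v, elem_pa_map g v i = v k.
Proof. by move=> e v; rewrite elem_pa_mapE e. Qed.

Lemma elem_pa_map_cases g i :
  (exists k, forall v, elem_pa_map g v i = v k) \/
  (forall v, elem_pa_map g v i = 0).
Proof.
case e: (obj_trans g^-1%g i) => [k|]; last by right=> v; rewrite elem_pa_mapE e.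
by left; exists k; exact: elem_pa_map_Some.
Qed.

Lemma elem_pa_map_comp g h v i : A_ i g ->
  elem_pa_map g (elem_pa_map h v) i = elem_pa_map (g * h)%g v i.
Proof.
move=> gi; have [k ek] : exists k, ltrans g^-1%g (A_ i) = A_ k.
  by apply/ed_obj_trans; rewrite invgK.
move/obj_transP: ek => ek.
apply: etrans (elem_pa_map_Some ek (elem_pa_map h v)) _.
apply: etrans (elem_pa_mapE h v k) _.
apply: etrans _ (esym (elem_pa_mapE (g * h)%g v i)).
by rewrite invgM (obj_transM _ ek).
Qed.

Lemma elem_pa_mapVK g v : elem_pa_dom g v ->
  elem_pa_map g (elem_pa_map g^-1%g v) = v.
Proof.
move=> /elem_pa_domP v0; apply/ffunP => i.
have [gi|ni] := pselect (A_ i g).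
  by rewrite elem_pa_map_comp // mulgV elem_pa_map_id.
by rewrite v0 //; have /elem_pa_domP := elem_pa_map_in g (elem_pa_map g^-1%g v);
  apply.
Qed.

Lemma elem_pa_mapKV g v : elem_pa_dom g^-1%g v ->
  elem_pa_map g^-1%g (elem_pa_map g v) = v.
Proof. by have := @elem_pa_mapVK g^-1%g v; rewrite invgK. Qed.

Fact elem_pa_ideal g : two_sided_ideal (elem_pa_dom g).
Proof.
split=> [|u v|k u|u v|u v].
- by apply/elem_pa_domP => i _; rewrite ffunE.
- move=> /elem_pa_domP u0 /elem_pa_domP v0; apply/elem_pa_domP => i ni.
  by rewrite ffunE u0 // v0 // addr0.
- move=> /elem_pa_domP u0; apply/elem_pa_domP => i ni.
  by rewrite ffunE u0 // scaler0.
- move=> /elem_pa_domP v0; apply/elem_pa_domP => i ni.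
  by rewrite ffunE v0 // mulr0.
- move=> /elem_pa_domP u0; apply/elem_pa_domP => i ni.
  by rewrite ffunE u0 // mul0r.
Qed.

Fact elem_pa_bij g :
  set_bij (elem_pa_dom g^-1%g) (elem_pa_dom g) (elem_pa_map g).
Proof.
split=> [v _|u v /set_mem Du /set_mem Dv e|v Dv].
- exact: elem_pa_map_in.
- exact: etrans (esym (elem_pa_mapKV Du))
    (etrans (congr1 (elem_pa_map g^-1%g) e) (elem_pa_mapKV Dv)).
- exists (elem_pa_map g^-1%g v); first exact: elem_pa_map_in.
  exact: elem_pa_mapVK.
Qed.

Fact elem_pa_mapD g : {in elem_pa_dom g^-1%g &,
  {morph elem_pa_map g : u v / u + v}}.
Proof.
move=> u v _ _; apply/ffunP=> i; have := elem_pa_map_cases g i.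
by move: (elem_pa_map g) => m [[l E]|E]; rewrite [RHS]ffunE !E ?ffunE ?addr0.
Qed.

Fact elem_pa_mapZ g (k : K) : {in elem_pa_dom g^-1%g,
  {morph elem_pa_map g : v / k *: v}}.
Proof.
move=> v _; apply/ffunP=> i; have := elem_pa_map_cases g i.
by move: (elem_pa_map g) => m [[l E]|E]; rewrite [RHS]ffunE !E ?ffunE ?scaler0.
Qed.

Fact elem_pa_mapM g : {in elem_pa_dom g^-1%g &,
  {morph elem_pa_map g : u v / u * v}}.
Proof.
move=> u v _ _; apply/ffunP=> i; have := elem_pa_map_cases g i.
by move: (elem_pa_map g) => m [[l E]|E]; rewrite [RHS]ffunE !E ?ffunE ?mulr0.
Qed.

Fact elem_pa_dom1 : elem_pa_dom 1%g = setT.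
Proof.
apply/seteqP; split=> // v _; apply/elem_pa_domP => i; case.
exact: ed_obj1.
Qed.

Lemma elem_pa_supp h v l : elem_pa_dom h^-1%g v -> v l != 0 ->
  exists2 k, ltrans h (A_ l) = A_ k & elem_pa_map h v k = v l.
Proof.
move=> /elem_pa_domP v0 vl.
have : A_ l h^-1%g by apply: contrapT => /v0 /eqP; apply/negP.
case/ed_obj_trans=> k ek; exists k => //; rewrite elem_pa_mapE.
by have /obj_transP -> : ltrans h^-1%g (A_ k) = A_ l
  by rewrite -ek ltransM mulVg ltrans1.
Qed.

Fact elem_pa_domM g h :
  pa_comp_dom elem_pa_dom elem_pa_map g h `<=` elem_pa_dom (g * h)^-1%g.
Proof.
move=> v [Dv [_ /elem_pa_domP hv]]; apply/elem_pa_domP => l nl.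
apply/eqP; apply/negPn/negP => vl; have [k ek vk] := elem_pa_supp Dv vl.
move: vl; rewrite -vk hv ?eqxx // -ek => /ltransP gk; apply: nl.
by rewrite invgM.
Qed.

Fact elem_pa_mapMg g h v : pa_comp_dom elem_pa_dom elem_pa_map g h v ->
  elem_pa_map g (elem_pa_map h v) = elem_pa_map (g * h)%g v.
Proof.
move=> [Dv _]; apply/ffunP => i.
have [gi|ni] := pselect (A_ i g); first exact: elem_pa_map_comp.
have /elem_pa_domP/(_ _ ni) e0 := elem_pa_map_in g (elem_pa_map h v).
apply: etrans e0 _; rewrite elem_pa_mapE; case el: obj_trans => [l|] //=.
apply/esym/eqP; apply/negPn/negP => /(elem_pa_supp Dv)[k ek _]; apply: ni.
move/obj_transP: el => el.
have e : ltrans g^-1%g (A_ i) = A_ k by rewrite -ek -el ltransM invgM mulVKg.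
by have := ed_obj1 k; rewrite -e => /ltransP; rewrite invgK mulg1.
Qed.

Definition elem_action : partial_action G Kn :=
  @Build_partial_action G K Kn elem_pa_dom elem_pa_map elem_pa_ideal
    elem_pa_bij elem_pa_mapD elem_pa_mapZ elem_pa_mapM elem_pa_dom1
    elem_pa_map_id elem_pa_domM elem_pa_mapMg.

Definition elem_phi (a : skew_group_ring elem_action) : M :=
  \sum_(g <- msupp (skew_val a)) elem_diag (skew_val a)@_g * elem_rep g.

End Elementary.

(* Main.v *)
(** In coordinates, the entry of [phi a] at position (i, j) has coefficient
    [a_(g_i h g_j^-1) i] at [h] in [H].  Conversely [a_g i = 0] unless [g] is in
    [A_i], and then [g^-1 A_i = A_j] for a unique [j], so [h = g_i^-1 g g_j] is
    in [H] and [g = g_i h g_j^-1]: the coordinates of [a] and of [phi a] are in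
    bijection.  The product is preserved because [pi g] moves [alpha_(g^-1) u]
    across to [u], and because [pi] is a partial representation. *)

Require Import Defs.
From HB Require Import structures.
From mathcomp Require Import all_boot all_order all_algebra.
From mathcomp Require Import finmap monalg.
From mathcomp Require Import boolp classical_sets functions cardinality.

Import GRing.Theory.

Local Open Scope ring_scope.

Section ElementaryPhi.
Set Implicit Arguments.
Unset Strict Implicit.
Variables (K : fieldType) (G : groupType) (d : elementary_data G).
Local Notation A := (ed_set d).
Local Notation I := ('I_(ed_n d).+1).
Local Notation A_ := (@ed_obj G d).
Local Notation g_ := (@ed_elt G d).
Local Notation H := (stab_group A).
Local Notation KH := (stab_algebra K d).
Local Notation M := (matrix_algebra KH (ed_n d)).
Local Notation Kn := (power_algebra K (ed_n d)).
Local Notation rep := (@elem_rep K G d).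
Local Notation diag := (@elem_diag K G d).
Local Notation act := (@elem_pa_map K G d).

(** The formula of [elem_phi], extended to all finitely supported families. Sums can then be split
    into single terms [<< v *g g >>] without carrying proofs that v lies in D_g. *)
Definition diag_rep_sum (a : {malg Kn[G]}) : M :=
  \sum_(g <- msupp a) diag a@_g * rep g.

Lemma mcoeff_stab_basis (x : G) (h : H) :
  (stab_basis K d x : {malg K[H]})@_h = (x == val h)%:R.
Proof.
have [/mem_set Hx|Hx] := pselect (stab A x).
  rewrite -[x]/(val (Sub x Hx : H)) stab_basisE mcoeffU.
  by rewrite (inj_eq val_inj).
rewrite stab_basis0 // mcoeff0; case: eqP => // e; case: Hx.
by rewrite e; exact: set_mem (valP h).
Qed.

Definition mx_coef (X : M) (i j : I) (h : H) : K :=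
  ((X : 'M[KH]_(_)) i j : {malg K[H]})@_h.

Lemma mx_coefP (X Y : M) :
  (forall i j h, mx_coef X i j h = mx_coef Y i j h) -> X = Y.
Proof. by move=> e; apply/matrixP => i j; apply/malgP => h; exact: e. Qed.

Lemma mx_coefD (X Y : M) i j h :
  mx_coef (X + Y) i j h = mx_coef X i j h + mx_coef Y i j h.
Proof. by rewrite -[RHS]mcoeffD; congr mcoeff; rewrite mxE. Qed.

Lemma mx_coefZ (k : K) (X : M) i j h :
  mx_coef (k *: X) i j h = k * mx_coef X i j h.
Proof.
rewrite /mx_coef; have -> : (k *: X : M) i j = k *: (X : 'M[KH]_(_)) i j.
  exact: mxa_scaleE.
exact: mcoeffZ.
Qed.

(** Entry (i, j) of [rep g] is the basis element at g_i^-1 g g_j, or 0 if this is not in H. It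
    equals h only for g = g_i h g_j^-1, so at most one term of the sum contributes. *)
Lemma diag_rep_sum_coef (a : {malg Kn[G]}) (i j : I) (h : H) :
  mx_coef (diag_rep_sum a) i j h =
  (a@_(g_ i * val h * (g_ j)^-1)%g : Kn) i.
Proof.
have eg g : ((g_ i)^-1 * g * g_ j == val h)%g = (g == g_ i * val h * (g_ j)^-1)%g.
  apply/eqP/eqP => [<-|->]; first by rewrite !mulgA mulgK mulgV mul1g.
  by rewrite !mulgA mulgVK mulVg mul1g.
rewrite /mx_coef /diag_rep_sum summxE raddf_sum /=.
transitivity (\sum_(g <- msupp a)
    if g == (g_ i * val h * (g_ j)^-1)%g then (a@_g : Kn) i else 0).
  apply: eq_bigr => g _.
  have -> := mul_elem_diag a@_g (rep g) i j.
  rewrite elem_repE mcoeffZ mcoeff_stab_basis eg.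
  by case: eqP => _; rewrite ?mulr1 ?mulr0.
rewrite -big_mkcond big_fset_condE /=.
set x := (_ * _ * _)%g.
(* The filtered index set is {x} or empty; off the support, a_x = 0 makes both sides zero. *)
have [ax|/mcoeff_outdom ax] := boolP (x \in msupp a).
  rewrite (_ : [fset _ | _ in _ & _]%fset = [fset x]%fset) ?big_seq_fset1 //.
  apply/fsetP => y; rewrite !inE andbC; case: eqP => // ->.
  by rewrite ax.
rewrite big_seq big1 => [|y]; last first.
  by rewrite !inE => /andP[_ /eqP ->]; rewrite ax ffunE.
by rewrite ax ffunE.
Qed.

Lemma diag_rep_sumD (a b : {malg Kn[G]}) :
  diag_rep_sum (a + b) = diag_rep_sum a + diag_rep_sum b.
Proof.
apply: mx_coefP => i j h.
apply: etrans (diag_rep_sum_coef (a + b) i j h) _.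
apply: etrans _ (esym (mx_coefD _ _ i j h)).
by rewrite mcoeffD ffunE; congr (_ + _); exact/esym/diag_rep_sum_coef.
Qed.

Lemma diag_rep_sum0 : diag_rep_sum 0 = 0.
Proof. by rewrite /diag_rep_sum msupp0 big_seq_fset0. Qed.

Lemma diag_rep_sumU (v : Kn) (g : G) :
  diag_rep_sum << v *g g >> = diag v * rep g.
Proof.
rewrite /diag_rep_sum msuppU; case: eqP => [->|_].
  by rewrite big_seq_fset0 linear0 mul0r.
by rewrite big_seq_fset1 mcoeffUU.
Qed.

(** Entry (i, j) of [rep g] vanishes unless g A_j = A_i, and then coordinate j of [act g^-1 u] is
    u_i. Weighting column j by the former thus agrees with weighting row i by the latter. *)
Lemma rep_diag_act (g : G) (u : Kn) :
  rep g * diag (act g^-1%g u) = diag u * rep g.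
Proof.
apply/matrixP => i j.
apply: etrans (mul_mx_elem_diag (act g^-1%g u) (rep g) i j) _.
apply: etrans _ (esym (mul_elem_diag u (rep g) i j)).
rewrite elem_repE.
have [/stab_trans/obj_transP e|Hs] :=
  pselect (stab A ((g_ i)^-1 * g * g_ j)%g).
  (* [act g^-1] finds its source index by translating with the inverse of g^-1. *)
  have {}e : obj_trans (g^-1)^-1%g j = Some i by rewrite invgK.
  exact (congr1 (fun k : K => k *: stab_basis K d _) (elem_pa_map_Some e u)).
by rewrite (stab_basis0 _ Hs) !scaler0.
Qed.

(** Column j of [rep g] is zero unless g^-1 is in A_j. *)
Lemma rep_indr (g : G) : rep g * diag (obj_ind K d g^-1%g) = rep g.
Proof.
apply/matrixP => i j.
apply: etrans (mul_mx_elem_diag (obj_ind K d g^-1%g) (rep g) i j) _.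
rewrite elem_repE ffunE.
have [Hs|Hs] := pselect (stab A ((g_ i)^-1 * g * g_ j)%g); last first.
  by rewrite (stab_basis0 _ Hs) scaler0.
rewrite mem_set ?scale1r //.
by apply/ed_obj_trans; exists i; exact/stab_trans.
Qed.

Lemma rep_skew_mul (g h : G) (u v : Kn) :
  diag (act g (act g^-1%g u * v)) * rep (g * h)%g =
  (diag u * rep g) * (diag v * rep h).
Proof.
(* Here p, q, r, t stand for pi at g, g^-1, h, gh, and e for the idempotent pi(g^-1) pi(g). After q
   t becomes e r, e moves left past the diagonal factors and is absorbed by p. *)
have gen (R : nzRingType) (p q r t e du du' dv : R) :
    q * t = e * r -> p * e = p -> e * (du' * dv) = du' * dv * e ->
    p * du' = du * p -> p * (du' * dv) * q * t = du * p * (dv * r).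
  move=> qt pe comm pdu; rewrite -!mulrA qt (mulrA dv) (mulrA du') (mulrA du').
  by rewrite -comm !mulrA pe pdu.
apply: etrans (congr1 ( *%R^~ _) (elem_pa_mapK g (act g^-1%g u * v))) _.
apply: etrans (congr1 (fun X => rep g * X * _ * _) (elem_diagM _ _)) _.
apply: (gen _ _ _ _ _ (diag (obj_ind K d g^-1%g))).
(* This is the axiom pi(g^-1) pi(g) pi(h) = pi(g^-1) pi(gh). *)
- have [_ _ E] := elem_rep_partial K d.
  exact: etrans (esym (E g h)) (congr1 ( *%R^~ _) (elem_idem_V K d g)).
- exact: rep_indr.
- apply: etrans (congr1 ( *%R _) (esym (elem_diagM _ _))) _.
  apply: etrans (esym (elem_diagM _ _)) _.
  apply: etrans _ (congr1 ( *%R^~ _) (elem_diagM _ _)).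
  apply: etrans _ (elem_diagM _ _).
  by congr elem_diag; apply/ffunP => i; rewrite !ffunE mulrC.
- exact: rep_diag_act.
Qed.

Lemma diag_rep_sum_mul (a b : skew_group_ring (elem_action K d)) :
  diag_rep_sum (skew_mul_val (elem_action K d) (skew_val a) (skew_val b)) =
  diag_rep_sum (skew_val a) * diag_rep_sum (skew_val b).
Proof.
rewrite /skew_mul_val (big_morph _ diag_rep_sumD diag_rep_sum0).
rewrite [X in _ = X * _]/diag_rep_sum mulr_suml; apply: eq_bigr => g _.
rewrite (big_morph _ diag_rep_sumD diag_rep_sum0).
rewrite [X in _ = _ * X]/diag_rep_sum mulr_sumr; apply: eq_bigr => h _.
by rewrite diag_rep_sumU; exact: rep_skew_mul.
Qed.

(** Each coefficient of the image is a single coordinate of the family, and these coordinates depend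
    linearly on it. *)
Lemma elem_phi_linear : linear (@elem_phi K G d).
Proof.
move=> k a b; apply: mx_coefP => i j h.
apply: etrans (diag_rep_sum_coef (skew_val (k *: a + b)) i j h) _.
apply: etrans _ (esym (mx_coefD _ _ i j h)).
apply: etrans _ (congr1 (+%R^~ _) (esym (mx_coefZ k (elem_phi a) i j h))).
have -> := skew_valD (k *: a) b.
rewrite mcoeffD ffunE; congr (_ + _); last exact/esym/diag_rep_sum_coef.
have -> := skew_scale_valE k (skew_val a) (g_ i * val h * (g_ j)^-1)%g.
by rewrite ffunE; congr (_ * _); exact/esym/diag_rep_sum_coef.
Qed.

Lemma elem_phi_inj : injective (@elem_phi K G d).
Proof.
move=> a b eab; apply/val_inj/malgP => g; apply/ffunP => i.
(* Coordinates with g outside A_i are not seen by the matrix; membership in D_g forces them to be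
   0. *)
have [gi|ni] := pselect (A_ i g); last first.
  apply: etrans (proj1 (elem_pa_domP g _) (skew_valP a g) i ni) _.
  exact: esym (proj1 (elem_pa_domP g _) (skew_valP b g) i ni).
have [j ej] : exists j, ltrans g^-1%g (A_ i) = A_ j.
  by apply/ed_obj_trans; rewrite invgK.
have Hs : stab A ((g_ i)^-1 * g * g_ j)%g.
  by apply/stab_trans; rewrite -ej ltransM mulgV ltrans1.
pose h : H := Sub ((g_ i)^-1 * g * g_ j)%g (mem_set Hs).
have eg : g = (g_ i * val h * (g_ j)^-1)%g.
  by rewrite SubK !mulgA mulgK mulgV mul1g.
rewrite eg; apply: etrans (esym (diag_rep_sum_coef (skew_val a) i j _)) _.
apply: etrans _ (diag_rep_sum_coef (skew_val b) i j _).
exact: (congr1 (fun X => mx_coef X i j _) eab).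
Qed.

Definition unit_vec (i : I) (k : K) : Kn := [ffun l => if l == i then k else 0].

(** Built on matrix units: the entry k h at position (i, j) comes from (k e_i) delta_g with g = g_i
    h g_j^-1. *)
Definition phi_inv_val (X : M) : {malg Kn[G]} :=
  \sum_i \sum_j \sum_(h <- msupp ((X : 'M[KH]_(_)) i j : {malg K[H]}))
    << unit_vec i ((X : 'M[KH]_(_)) i j : {malg K[H]})@_h *g
       (g_ i * val h * (g_ j)^-1)%g >>.

(** The element g = g_i h g_j^-1 sends A_j to A_i. Since 1 is in A_j, g is in A_i, so k e_i lies in
    D_g. *)
Lemma phi_inv_subproof (X : M) : skew_pred (elem_action K d) (phi_inv_val X).
Proof.
apply: (@rpred_sum _ (skew_pred (elem_action K d))) => i _.
apply: rpred_sum => j _; apply: rpred_sum => h _.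
apply/skew_predP => g; apply/elem_pa_domP => l nl; rewrite mcoeffU.
case: eqP => [eg|_]; last by rewrite mulr0n ffunE.
rewrite mulr1n ffunE; case: eqP => // el; case: nl; rewrite el -eg.
have /stab_trans <- : stab A ((g_ i)^-1 * (g_ i * val h * (g_ j)^-1) * g_ j)%g.
  by rewrite !mulgA mulgVK mulVg mul1g; exact: set_mem (valP h).
by apply/ltransP; rewrite mulVg; exact: ed_obj1.
Qed.

Definition phi_inv (X : M) : skew_group_ring (elem_action K d) :=
  Skew (phi_inv_subproof X).

Lemma phi_invK : cancel phi_inv (@elem_phi K G d).
Proof.
move=> X; change (diag_rep_sum (phi_inv_val X) = X).
have term i j (h : H) (k : K) :
    diag_rep_sum << unit_vec i k *g (g_ i * val h * (g_ j)^-1)%g >> =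
    (<< k *g h >> : KH) *: delta_mx i j :> 'M_(_).
  rewrite diag_rep_sumU; apply/matrixP => i' j'.
  have -> := mul_elem_diag (unit_vec i k) (rep _) i' j'.
  rewrite elem_repE !mxE ffunE.
  have [->|_] := eqVneq i' i; last by rewrite scale0r mulr0.
  have ejj : ((g_ i)^-1 * (g_ i * val h * (g_ j)^-1) * g_ j = val h)%g.
    by rewrite !mulgA mulgVK mulVg mul1g.
  have Hh : stab A (val h) by exact: set_mem (valP h).
  have [->|jj] := eqVneq j' j.
    rewrite ejj stab_basisE mulr1.
    by have -> := ga_scaleU k 1 h; rewrite mulr1.
  (* A second nonzero entry in row i would give g A_j' = A_i = g A_j; cancelling g yields j' = j. *)
  rewrite mulr0 stab_basis0 ?scaler0 // => /stab_trans e.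
  move: Hh; rewrite -ejj => /stab_trans; rewrite -e.
  move=> /(congr1 (ltrans (g_ i * val h * (g_ j)^-1)^-1%g)).
  rewrite !ltransM mulVg !ltrans1 => /ed_obj_inj ej.
  by rewrite ej eqxx in jj.
apply: etrans (big_morph _ diag_rep_sumD diag_rep_sum0 _ _ _) _.
apply: etrans _ (esym (matrix_sum_delta _)); apply: eq_bigr => i _.
apply: etrans (big_morph _ diag_rep_sumD diag_rep_sum0 _ _ _) _.
apply: eq_bigr => j _.
apply: etrans (big_morph _ diag_rep_sumD diag_rep_sum0 _ _ _) _.
apply: etrans (eq_bigr _ (fun h _ => term i j h _)) _.
rewrite -scaler_suml; congr (_ *: _).
exact: (esym (monalgE _)).
Qed.

End ElementaryPhi.

Theorem corollary6p12 (K : fieldType) (G : groupType) (d : elementary_data G) :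
  [/\ linear (@elem_phi K G d),
      {morph @elem_phi K G d : a b / skew_mul a b >-> a * b}
    & bijective (@elem_phi K G d)].
Proof.
split; first exact: elem_phi_linear.
  by move=> a b; exact: diag_rep_sum_mul.
exists (@phi_inv K G d); last exact: phi_invK.
(* Injectivity turns the right inverse into a left inverse. *)
by apply: inj_can_sym; [exact: phi_invK | exact: elem_phi_inj].
Qed.
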